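(* Let $\hat x_0$ be any solution obtained using Phase 1 data $D_1$, let $k=(k_j)_{j=1,\ldots,l}\in\mathbb R^l$ be a vector with positive entries, and suppose $\rho$ is an upper bound, with confidence level $1-\delta$ and generated under Phase 2 data $D_2$, of the $(1-\epsilon)$-quantile of $$\max_{j=1,\ldots,l}\frac{g_j(\hat x_0;\xi)-b_j}{k_j}.$$ Then any feasible solution of $$\text{minimize } f(x)\ \text{ subject to }\ g(x;\xi)\le b\ \ \forall\,\xi:\ g(\hat x_0;\xi)\le b+\rho k$$ is also feasible, with the same confidence $1-\delta$, for the chance-constrained program $$\text{minimize } f(x)\ \text{ subject to }\ P(g(x;\xi)\le b)\ge 1-\epsilon .$$
   Context: $\epsilon,\delta\in(0,1)$; $x\in\mathbb R^d$ is the decision vector, $f$ a real-valued objective, $\xi\in\mathbb R^m$ a random vector with distribution $P$, $g(x;\xi)=(g_j(x;\xi))_{j=1,\ldots,l}\in\mathbb R^l$, $b=(b_j)_{j=1,\ldots,l}\in\mathbb R^l$; vector inequalities are componentwise. The data $D$ is an i.i.d. sample from $P$, split into two disjoint (hence independent) groups, Phase 1 data $D_1$ and Phase 2 data $D_2$. The $(1-\epsilon)$-quantile of a real random variable $Y$ is $\inf\{y:P(Y\le y)\ge 1-\epsilon\}$. Let $q$ be the $(1-\epsilon)$-quantile of the displayed maximum for $\xi\sim P$ a fresh draw with $\hat x_0$ (i.e. $D_1$) held fixed. That $\rho$ is an upper bound of $q$ with confidence level $1-\delta$ generated under Phase 2 data means that, conditional on $D_1$, $\mathbb P_{D_2}(q\le\rho\,|\,D_1)\ge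 1-\delta$, where $\mathbb P_{D_2}$ is probability with respect to $D_2$. ''Feasible with confidence $1-\delta$'' means that, with probability at least $1-\delta$ with respect to the data $D$, the feasible solution in question satisfies the chance constraint. *)

(* Defs.v *)
From HB Require Import structures.
From mathcomp Require Import all_boot all_order all_algebra.
From mathcomp Require Import all_classical all_reals all_analysis.

Set Implicit Arguments.
Unset Strict Implicit.
Unset Printing Implicit Defensive.

Import Order.TTheory GRing.Theory Num.Theory.
Import numFieldNormedType.Exports.
Local Open Scope classical_set_scope.
Local Open Scope ring_scope.

(* A realization of the random vector xi in R^m is an m.-tuple R, whose
   canonical sigma-algebra is the product of the Borel ones; vectors that need
   no sigma-algebra are row vectors. *)

Definition vle (R : realType) (n : nat) (u v : 'rV[R]_n) : Prop :=
  forall j, u 0 j <= v 0 j.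

Definition quantile d (T : measurableType d) (R : realType)
    (P : probability T R) (p : R) (Y : T -> R) : R :=
  inf [set y | (p%:E <= P [set t | (Y t <= y)%R])%E].

(* Independence of subfamilies is the case where some A i are setT. *)
Definition iid_sample d d' (Omega : measurableType d) (T : measurableType d')
    (R : realType) (Pr : probability Omega R) (P : probability T R)
    (n : nat) (xi : 'I_n -> {RV Pr >-> T}) : Prop :=
  (forall i A, measurable A -> Pr (xi i @^-1` A) = P A) /\
  (forall A : 'I_n -> set T, (forall i, measurable (A i)) ->
     Pr [set w | forall i, A i (xi i w)] =
     (\big[*%E/1]_(i < n) Pr (xi i @^-1` A i))%E).

Definition phase1 (Omega T : Type) (n1 n2 : nat)
    (xi : 'I_(n1 + n2) -> Omega -> T) (w : Omega) : n1.-tuple T :=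
  [tuple xi (lshift n2 i) w | i < n1].

Definition phase2 (Omega T : Type) (n1 n2 : nat)
    (xi : 'I_(n1 + n2) -> Omega -> T) (w : Omega) : n2.-tuple T :=
  [tuple xi (rshift n1 i) w | i < n2].

(* Inner-measure reading: agrees with p <= Pr A when A is measurable, and stays
   meaningful for sets A defined by an uncountable quantification. *)
Definition with_probability_at_least d (Omega : measurableType d)
    (R : realType) (Pr : probability Omega R) (p : R) (A : set Omega) : Prop :=
  exists E : set Omega, [/\ measurable E, E `<=` A & (p%:E <= Pr E)%E].

Record program (X : Type) (R : realType) :=
  Program { objective : X -> R ; feasible : set X }.

Section Programs.
Variables (R : realType) (d m l : nat).
Variables (f : 'rV[R]_d -> R) (g : 'rV[R]_d -> m.-tuple R -> 'rV[R]_l.+1).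
Variable b : 'rV[R]_l.+1.

Definition chance_constrained_program (P : probability (m.-tuple R) R)
    (eps : R) : program 'rV[R]_d R :=
  Program f [set x | ((1 - eps)%:E <= P [set xi | vle (g x xi) b])%E].

Definition reconstructed_program (k : 'rV[R]_l.+1) (x0 : 'rV[R]_d)
    (rho : R) : program 'rV[R]_d R :=
  Program f [set x | forall xi, vle (g x0 xi) (b + rho *: k) ->
                                vle (g x xi) b].

Definition max_ratio (k : 'rV[R]_l.+1) (x0 : 'rV[R]_d)
    (xi : m.-tuple R) : R :=
  let r j := (g x0 xi 0 j - b 0 j) / k 0 j in
  \big[Num.max/r ord0]_(j < l.+1) r j.

End Programs.

(* q is a function of the Phase 1 data and rho of both phases.  Conditioning on
   D1 is freezing it at D1 w, for almost every w, the remaining probability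
   being over D2 alone: D1 and D2 are independent. *)
Definition confidence_upper_bound d (Omega : measurableType d) (R : realType)
    (Pr : probability Omega R) (delta : R) (T1 T2 : Type)
    (D1 : Omega -> T1) (D2 : Omega -> T2)
    (q : T1 -> R) (rho : T1 -> T2 -> R) : Prop :=
  {ae Pr, forall w, ((1 - delta)%:E <=
     Pr [set w' | (q (D1 w) <= rho (D1 w) (D2 w'))%R])%E}.

(* Main.v *)
Require Import Defs.
From mathcomp Require Import all_boot all_order all_algebra.
From mathcomp Require Import all_classical all_reals all_analysis.
From mathcomp Require Import measurable_realfun.
Import Order.TTheory GRing.Theory Num.Theory.
Import numFieldNormedType.Exports.
Local Open Scope classical_set_scope.
Local Open Scope ring_scope.

(** Everything happens on the event [q <= rho], where [q] is the quantile
computed from the Phase 1 data.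

On that event the inclusion of feasible sets is deterministic.  Since the
entries of [k] are positive, [max_ratio <= r] is the vector inequality
[g x0 xi <= b + r k] ([max_ratio_leP]).  A point feasible for the reconstructed
program satisfies [g x xi <= b] whenever [max_ratio <= rho], hence whenever
[max_ratio <= q], and the latter has probability at least [1 - eps] because the
infimum defining a quantile is attained ([quantile_le_cdf]).

It remains to see that the event has probability at least [1 - delta], although
the hypothesis on [rho] bounds its conditional probability only, with the Phase 1
data frozen.  The joint law of the two phases is the product of their laws, so
Fubini expresses the probability of the event as the mean of the conditional
ones ([phases_Fubini]), and a mean of numbers almost surely at least [1 - delta]
is at least [1 - delta]. *)

(** The set whose infimum is the quantile contains this infimum, by
right-continuity of the cumulative distribution function.  That set is nonempty
since the distribution function tends to [1 > p]; for [p <= 0] it is the whole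
line, whose infimum is [0] by convention, and the conclusion is trivial. *)
Lemma quantile_le_cdf d (T : measurableType d) (R : realType)
    (P : probability T R) (p : R) (Y : T -> R) :
  p < 1 -> measurable_fun setT Y ->
  (p%:E <= P [set t | (Y t <= quantile P p Y)%R])%E.
Proof.
move=> p1 mY.
pose X : {RV P >-> R} := mfun_Sub (mem_set mY).
have cdfE r : cdf X r = P [set t | Y t <= r].
  by rewrite /cdf /distribution /pushforward /= set_itvE.
set A := [set y | (p%:E <= P [set t | (Y t <= y)%R])%E].
have AE : A = [set y | (p%:E <= cdf X y)%E].
  by apply/seteqP; split => y /=; rewrite cdfE.
have A0 : A !=set0.
  apply/set0P/negP => /eqP A0.
  have : (1 <= p%:E)%E.
    apply: cvge_le (cvg_cdfy1 X); apply: nearW => r; rewrite leNgt.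
    by apply/negP => /ltW pr; have : set0 r by rewrite -A0 AE.
  by rewrite lee_fin leNgt p1.
rewrite -/(quantile P p Y) -cdfE /quantile -/A.
apply: (cvge_ge _ (@cdf_right_continuous _ _ _ _ X (inf A))).
near=> r.
have /(inf_lt A0)[y + yr] : inf A < r by near: r; exact: nbhs_right_gt.
rewrite AE => /le_trans; apply; exact/cdf_nondecreasing/ltW.
Unshelve. all: end_near.
Qed.

Section max_ratio_theory.
Variables (R : realType) (d m l : nat).
Variables (g : 'rV[R]_d -> m.-tuple R -> 'rV[R]_l.+1) (b k : 'rV[R]_l.+1).

Lemma max_ratio_leP x xi r : (forall j, 0 < k 0 j) ->
  max_ratio g b k x xi <= r <-> vle (g x xi) (b + r *: k).
Proof.
move=> k_gt0.
have ratio_le j : ((g x xi 0 j - b 0 j) / k 0 j <= r) =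
    (g x xi 0 j <= (b + r *: k) 0 j).
  by rewrite ler_pdivrMr// lerBlDl !mxE.
split => [/bigmax_leP[_ le_r] j|le_r]; first by rewrite -ratio_le le_r.
by apply/bigmax_leP; split => [|j _]; rewrite ratio_le.
Qed.

Hypothesis mg : forall x j, measurable_fun setT (fun xi => g x xi 0 j).

Lemma measurable_vle x v : measurable [set xi | vle (g x xi) v].
Proof.
have -> : [set xi | vle (g x xi) v] =
    \bigcap_(j in [set: 'I_l.+1]) [set xi | g x xi 0 j <= v 0 j].
  by apply/seteqP; split => [xi H j _|xi H j]; exact: H.
apply: fin_bigcap_measurable => // j _.
have := mg x j measurableT [set` `]-oo, v 0 j]] (measurable_itv _).
by rewrite setTI set_itvE.
Qed.

Lemma measurable_max_ratio x : measurable_fun setT (max_ratio g b k x).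
Proof.
have mratio j : measurable_fun setT
    (fun xi => (g x xi 0 j - b 0 j) / k 0 j).
  by apply: measurable_funM => //; exact: measurable_funB.
rewrite /max_ratio; elim: (index_enum _) => [|j s IHs].
  by under eq_fun do rewrite big_nil; exact: mratio.
under eq_fun do rewrite big_cons.
exact: measurable_maxr.
Qed.

(** The part of the theorem that holds outcome by outcome: it is read at the
values of [x0] and [rho] computed from data for which the bound on the quantile
is correct. *)
Lemma reconstructed_feasible (f : 'rV[R]_d -> R)
    (P : probability (m.-tuple R) R) (eps r : R) x0 :
  (forall j, 0 < k 0 j) -> 0 < eps ->
  quantile P (1 - eps) (max_ratio g b k x0) <= r ->
  feasible (reconstructed_program f g b k x0 r) `<=`
  feasible (chance_constrained_program f g b P eps).
Proof.
move=> k_gt0 eps_gt0 q_le_r x xfeas /=.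
have eps_lt1 : 1 - eps < 1 by rewrite gtrBl.
have mY := measurable_max_ratio x0.
set q := quantile _ _ _ in q_le_r.
apply: (le_trans (quantile_le_cdf _ _ _ P _ _ eps_lt1 mY)).
apply: le_measure; rewrite ?inE.
- have := mY measurableT [set` `]-oo, q]] (measurable_itv _).
  by rewrite setTI set_itvE.
- exact: measurable_vle.
- move=> xi /= Yq; apply: xfeas; apply/(max_ratio_leP _ _ _ k_gt0).
  exact: le_trans Yq q_le_r.
Qed.

End max_ratio_theory.

Section phases.
Context d d' (Omega : measurableType d) (T : measurableType d') (R : realType).
Variables (Pr : probability Omega R) (P : probability T R) (n1 n2 : nat).
Variable xi : 'I_(n1 + n2) -> {RV Pr >-> T}.

Lemma measurable_phase1 : measurable_fun setT (phase1 xi).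
Proof.
apply/measurable_fun_tnthP => i.
rewrite (_ : _ \o _ = xi (lshift n2 i)); first exact: measurable_funPT.
by apply/funext => w /=; rewrite tnth_mktuple.
Qed.

Lemma measurable_phase2 : measurable_fun setT (phase2 xi).
Proof.
apply/measurable_fun_tnthP => i.
rewrite (_ : _ \o _ = xi (rshift n1 i)); first exact: measurable_funPT.
by apply/funext => w /=; rewrite tnth_mktuple.
Qed.

Definition box n (A : 'I_n -> set T) : set (n.-tuple T) :=
  [set D | forall i, A i (tnth D i)].

Lemma box_setT n : box n (fun=> setT) = setT.
Proof. by apply/seteqP; split. Qed.

Lemma box_setI n (A B : 'I_n -> set T) :
  box n (fun i => A i `&` B i) = box n A `&` box n B.
Proof.
apply/seteqP; split => [D H|D [HA HB] i]; last by split.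
by split => i; have [] := H i.
Qed.

Lemma measurable_box n (A : 'I_n -> set T) :
  (forall i, measurable (A i)) -> measurable (box n A).
Proof.
move=> mA.
rewrite (_ : box n A = \bigcap_(i in setT) (fun D => tnth D i) @^-1` A i).
  apply: fin_bigcap_measurable => // i _; rewrite -[X in measurable X]setTI.
  exact: measurable_tnth.
by apply/seteqP; split => [D H i _|D H i]; exact: H.
Qed.

(** A pi-system for the product sigma-algebra that constrains all observations
of both phases at once: the independence of the single observations then gives
the joint law of the phases in one application of the uniqueness of measures,
without a separate argument for each phase. *)
Definition boxes : set (set (n1.-tuple T * n2.-tuple T)) :=
  [set S | exists A B, [/\ forall i, measurable (A i),
     forall i, measurable (B i) & S = box n1 A `*` box n2 B]].

Lemma boxes_setT : boxes setT.
Proof.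
by exists (fun=> setT), (fun=> setT); split => //; rewrite !box_setT setXTT.
Qed.

Lemma boxes_setI : setI_closed boxes.
Proof.
move=> _ _ [A [B [mA mB ->]]] [A' [B' [mA' mB' ->]]].
exists (fun i => A i `&` A' i), (fun i => B i `&` B' i); split.
- by move=> i; exact: measurableI.
- by move=> i; exact: measurableI.
- by rewrite !box_setI setXI.
Qed.

(** Every coordinate projection is measurable for the sigma-algebra that the
boxes generate, a single constrained coordinate being a box; as the product
sigma-algebra is the smallest with this property, it is the generated one. *)
Lemma measurable_boxesE : measurable = <<s boxes >>.
Proof.
apply/seteqP; split; last first.
  apply: smallest_sub; first exact: sigma_algebra_measurable.
  by move=> _ [A [B [mA mB ->]]]; apply: measurableX; exact: measurable_box.
pose h : g_sigma_algebraType boxes -> n1.-tuple T * n2.-tuple T := id.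
suff mh : measurable_fun setT h.
  by move=> S mS; have := mh measurableT S mS; rewrite setTI.
apply/measurable_fun_pairP; split; apply/measurable_fun_tnthP => i _ S mS.
  rewrite setTI; apply: sub_sigma_algebra.
  exists (fun j => if j == i then S else setT), (fun=> setT); split => //.
    by move=> j; case: ifP.
  apply/seteqP; split => [D DS|D [/(_ i)]/=]; last by rewrite eqxx.
  by split => // j /=; case: ifPn => // /eqP ->.
rewrite setTI; apply: sub_sigma_algebra.
exists (fun=> setT), (fun j => if j == i then S else setT); split => //.
  by move=> j; case: ifP.
apply/seteqP; split => [D DS|D [_ /(_ i)]/=]; last by rewrite eqxx.
by split => // j /=; case: ifPn => // /eqP ->.
Qed.

Let X1 : {RV Pr >-> n1.-tuple T} := mfun_Sub (mem_set measurable_phase1).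
Let X2 : {RV Pr >-> n2.-tuple T} := mfun_Sub (mem_set measurable_phase2).
Let X12 : {RV Pr >-> (n1.-tuple T * n2.-tuple T)%type} :=
  mfun_Sub (mem_set (measurable_fun_pair measurable_phase1 measurable_phase2)).
Let law1 : probability (n1.-tuple T) R := distribution Pr X1.
Let law2 : probability (n2.-tuple T) R := distribution Pr X2.

Lemma measurable_phase2_section (S : set (n1.-tuple T * n2.-tuple T)) :
  measurable S ->
  measurable_fun setT
    (fun w => Pr [set w' | S (phase1 xi w, phase2 xi w')]).
Proof.
move=> mS.
have := measurableT_comp (measurable_fun_xsection law2 mS) measurable_phase1.
apply: eq_measurable_fun => w _ /=; rewrite /law2 /distribution /pushforward.
by congr (Pr _); apply/seteqP; split => w' /=; rewrite /xsection/= inE.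
Qed.

Hypothesis iid_xi : iid_sample P xi.

Lemma phases_box A B : (forall i, measurable (A i)) ->
    (forall i, measurable (B i)) ->
  Pr (phase1 xi @^-1` box n1 A `&` phase2 xi @^-1` box n2 B) =
  (\prod_(i < n1) P (A i) * \prod_(i < n2) P (B i))%E.
Proof.
move=> mA mB; case: iid_xi => law indep.
pose C i := match fintype.split i with inl i1 => A i1 | inr i2 => B i2 end.
have mC i : measurable (C i) by rewrite /C; case: fintype.split.
have CA i : C (lshift n2 i) = A i by rewrite /C (unsplitK (inl i)).
have CB i : C (rshift n1 i) = B i by rewrite /C (unsplitK (inr i)).
transitivity (Pr [set w | forall i, C i (xi i w)]).
  congr (Pr _); apply/seteqP; split => w /=.
    move=> [HA HB] i; rewrite -(splitK i); case: (fintype.split i) => j /=.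
      by rewrite CA; have := HA j; rewrite tnth_mktuple.
    by rewrite CB; have := HB j; rewrite tnth_mktuple.
  move=> H; split => i; rewrite tnth_mktuple.
    by rewrite -CA; exact: H.
  by rewrite -CB; exact: H.
rewrite indep// big_split_ord/=.
congr (_ * _)%E; apply: eq_bigr => i _; rewrite law//.
  by rewrite CA.
by rewrite CB.
Qed.

(** Boxes that leave one phase free give the laws of the single phases, so that
the joint law and the product law agree on all boxes. *)
Lemma phases_law (S : set (n1.-tuple T * n2.-tuple T)) : measurable S ->
  distribution Pr X12 S = (law1 \x law2)%E S.
Proof.
move=> mS.
have prod_setT n : (\prod_(i < n) P setT = 1)%E.
  by rewrite big1// => i _; exact: probability_setT.
apply: (measure_unique boxes (fun=> setT) measurable_boxesE boxes_setI _ _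
  (distribution Pr X12) (law1 \x law2)%E) => //.
- by move=> _; exact: boxes_setT.
- by rewrite bigcup_const//; exists 0%N.
- move=> _ [A [B [mA mB ->]]].
  rewrite [RHS]product_measure1E; [|exact: measurable_box..].
  transitivity (\prod_(i < n1) P (A i) * \prod_(i < n2) P (B i))%E.
    exact: phases_box.
  congr (_ * _)%E; apply: esym.
    have := phases_box A (fun=> setT) mA (fun=> measurableT).
    by rewrite box_setT preimage_setT setIT prod_setT mule1.
  have := phases_box (fun=> setT) B (fun=> measurableT) mB.
  by rewrite box_setT preimage_setT setTI prod_setT mul1e.
- by move=> _; rewrite (le_lt_trans (probability_le1 _ measurableT))// ltry.
Qed.

(** The law of total probability, conditioning on the Phase 1 data: freezing
them and averaging over an independent copy recovers the joint probability. *)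
Lemma phases_Fubini (S : set (n1.-tuple T * n2.-tuple T)) : measurable S ->
  Pr [set w | S (phase1 xi w, phase2 xi w)] =
  (\int[Pr]_w Pr [set w' | S (phase1 xi w, phase2 xi w')])%E.
Proof.
move=> mS; rewrite [LHS](phases_law _ mS).
rewrite /product_measure1 ge0_integral_pushforward//=.
- apply: eq_integral => w _ /=; rewrite /law2 /distribution /pushforward.
  by congr (Pr _); apply/seteqP; split => w' /=; rewrite /xsection/= inE.
- exact: measurable_phase1.
- exact: measurable_fun_xsection.
Qed.

Lemma confidence_upper_bound_joint (delta : R) (q : n1.-tuple T -> R)
    (rho : n1.-tuple T -> n2.-tuple T -> R) : delta <= 1 ->
  measurable [set D : n1.-tuple T * n2.-tuple T | q D.1 <= rho D.1 D.2] ->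
  confidence_upper_bound Pr delta (phase1 xi) (phase2 xi) q rho ->
  ((1 - delta)%:E <=
   Pr [set w | (q (phase1 xi w) <= rho (phase1 xi w) (phase2 xi w))%R])%E.
Proof.
move=> delta1 mS bound; rewrite [leRHS](phases_Fubini _ mS).
apply: (@le_trans _ _ (\int[Pr]_w (1 - delta)%:E)%E).
  by rewrite integral_cst// [X in (_ * X)%E]probability_setT mule1.
apply: ae_ge0_le_integral => //=.
- by move=> _ _; rewrite lee_fin subr_ge0.
- exact: measurable_phase2_section mS.
- by apply: filterS bound => w H _.
Qed.

End phases.

Theorem corollary1 (R : realType) (d m l n1 n2 : nat)
  (eps delta : R) (heps : 0 < eps < 1) (hdelta : 0 < delta < 1)
  (f : 'rV[R]_d -> R)
  (g : 'rV[R]_d -> m.-tuple R -> 'rV[R]_l.+1) (b k : 'rV[R]_l.+1)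
  (hg : forall x j, measurable_fun setT (fun xi : m.-tuple R => g x xi 0 j))
  (hk : forall j, 0 < k 0 j)
  (P : probability (m.-tuple R) R)
  (disp : measure_display) (Omega : measurableType disp)
  (Pr : probability Omega R)
  (data : 'I_(n1 + n2) -> {RV Pr >-> m.-tuple R})
  (hdata : iid_sample P data)
  (x0 : n1.-tuple (m.-tuple R) -> 'rV[R]_d)
  (rho : n1.-tuple (m.-tuple R) -> n2.-tuple (m.-tuple R) -> R)
  (hmeas : measurable
     [set D : n1.-tuple (m.-tuple R) * n2.-tuple (m.-tuple R) |
        quantile P (1 - eps) (max_ratio g b k (x0 D.1)) <= rho D.1 D.2])
  (hrho : confidence_upper_bound Pr delta (phase1 data) (phase2 data)
     (fun D1 => quantile P (1 - eps) (max_ratio g b k (x0 D1))) rho) :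
  with_probability_at_least Pr (1 - delta)
    [set w | feasible (reconstructed_program f g b k (x0 (phase1 data w))
                         (rho (phase1 data w) (phase2 data w)))
             `<=` feasible (chance_constrained_program f g b P eps)].
Proof.
have [eps_gt0 _] := andP heps; have [_ delta_lt1] := andP hdelta.
exists [set w | quantile P (1 - eps) (max_ratio g b k (x0 (phase1 data w))) <=
                rho (phase1 data w) (phase2 data w)]; split.
- have mphases : measurable_fun setT
      (fun w => (phase1 data w, phase2 data w)).
    apply: measurable_fun_pair; first exact: measurable_phase1.
    exact: measurable_phase2.
  by rewrite -[X in measurable X]setTI; exact: (mphases measurableT _ hmeas).
- by move=> w; exact: reconstructed_feasible.
- apply: (confidence_upper_bound_joint _ _ _ _ _ _ _ _ _ _ hdata
    _ _ _ _ hmeas hrho); exact: ltW.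
Qed.
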